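(* Let $n\in\{2,3\}$ and let $(M^n,\mathcal T)$ be a closed triangulated $n$-manifold with vertices $1,\dots,N$ (with a fixed weight $\Phi:\mathcal T_1\to[0,\frac{\pi}{2}]$ on edges if $n=2$). Let $\Omega$ be its combinatorial conformal class, that is, $\Omega=\mathbb R^N_{>0}$, the space of circle packing metrics, if $n=2$, and $\Omega=\mathfrak M_{\mathcal T}$, the space of non-degenerate ball packing metrics, if $n=3$. Let $\alpha,\beta\in\mathbb R$ and consider the $(\alpha,\beta)$-flow on $\Omega$ $$\frac{dr_i}{dt}=s_\alpha r_i^{\beta}-K_i r_i^{\beta-\alpha},\qquad i=1,\dots,N,\qquad s_\alpha=\frac{\sum_{i=1}^N K_i r_i^{n-2}}{\sum_{i=1}^N r_i^{\alpha+n-2}}.$$ Then: (a) every critical point of the flow in $\Omega$ is a constant $\alpha$-curvature metric; (b) for every initial metric $r(0)\in\Omega$ the solution $r(t)$ of the flow exists locally, i.e. on some interval $[0,\epsilon)$ with $\epsilon>0$; (c) if a solution $r(t)$ of the flow converges, i.e. it exists in $\Omega$ for all $t\ge 0$ and there is $r^*\in\Omega$ with $r(t)\to r^*$ in the Euclidean topology as $t\to+\infty$, then there exists a constant $\alpha$-curvature metric in $\Omega$ (the combinatorial $\alpha$-Yamabe problem is solvable).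
   Context: A triangulated $n$-manifold $(M^n,\mathcal T)$ is a closed $n$-manifold with a triangulation $\mathcal T=\{\mathcal T_0,\dots,\mathcal T_n\}$, $\mathcal T_i$ being the set of $i$-simplices; $N$ is the number of vertices. Case $n=2$ (Thurston's circle packing metrics). A weight $\Phi:\mathcal T_1\to[0,\frac{\pi}{2}]$ is fixed. A circle packing metric is a map $r:\mathcal T_0\to(0,+\infty)$, identified with $r\in\mathbb R^N_{>0}=(0,+\infty)^N$. Each edge $\{ij\}$ gets length $l_{ij}=\sqrt{r_i^2+r_j^2+2r_ir_j\cos\Phi_{ij}}$; it is known (Thurston) that the three lengths on each face satisfy the triangle inequalities, so each face is realized as a Euclidean triangle. With $\theta_i^{jk}$ the inner angle at vertex $i$ of the triangle $\{ijk\}$, the discrete Gauss curvature is $K_i=2\pi-\sum_{\{ijk\}\in\mathcal T_2}\theta_i^{jk}$, summed over all triangles having $i$ as a vertex. Case $n=3$ (Cooper–Rivin ball packing metrics). For $r\in\mathbb R^N_{>0}$ each edge $\{ij\}$ gets length $l_{ij}=r_i+r_j$. The map $r$ is a (non-degenerate) ball packing metric if for each $\{i,j,k,l\}\in\mathcal T_3$ the six lengths are the edge lengths of a non-degenerate Euclidean tetrahedron, equivalently $$Q_{ijkl}=\Big(\tfrac1{r_i}+\tfrac1{r_j}+\tfrac1{r_k}+\tfrac1{r_l}\Big)^2-2\Big(\tfrac1{r_i^2}+\tfrac1{r_j^2}+\tfrac1{r_k^2}+\tfrac1{r_l^2}\Big)>0.$$ $\mathfrak M_{\mathcal T}=\{r\in\mathbb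 R^N_{>0}: Q_{ijkl}>0\ \text{for all}\ \{i,j,k,l\}\in\mathcal T_3\}$, an open subset of $\mathbb R^N_{>0}$. With $\alpha_{ijkl}$ the solid angle at vertex $i$ of the Euclidean tetrahedron $\{i,j,k,l\}$, the discrete scalar curvature is $K_i=4\pi-\sum_{\{i,j,k,l\}\in\mathcal T_3}\alpha_{ijkl}$, summed over all tetrahedra having $i$ as a vertex. A constant $\alpha$-curvature metric is a metric $r$ in the respective space for which $K_i/r_i^{\alpha}$ has the same value for all vertices $i$ (this value is then necessarily $s_\alpha$). *)

(* Defs.v *)
From HB Require Import structures.
From mathcomp Require Import all_boot all_order all_algebra.
From mathcomp Require Import ring lra.
From mathcomp Require Import all_classical all_reals all_analysis.
Set Implicit Arguments.
Unset Strict Implicit.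
Unset Printing Implicit Defensive.
Import Order.TTheory GRing.Theory Num.Theory.
Import numFieldNormedType.Exports.
Local Open Scope classical_set_scope.
Local Open Scope ring_scope.

Definition homeomorphic (X Y : topologicalType) (A : set X) (B : set Y) : Prop :=
  exists (f : X -> Y) (g : Y -> X),
    [/\ {homo f : x / A x >-> B x}, {homo g : y / B y >-> A y},
        forall x, A x -> g (f x) = x,
        forall y, B y -> f (g y) = y &
        {within A, continuous f} /\ {within B, continuous g}].

Definition closed_manifold (R : realType) (n : nat) (M : topologicalType) : Prop :=
  [/\ compact [set: M], hausdorff_space M, @second_countable M &
      forall x : M, exists (U : set M) (V : set 'rV[R]_n),
        [/\ open U, U x, open V & homeomorphic U V]].

(* Simplices are identified with their vertex sets; the vertices are all of
   ['I_N]. *)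
Definition simplicial_complex (N : nat) (T : {set {set 'I_N}}) : Prop :=
  [/\ finset.set0 \notin T,
      forall i : 'I_N, [set i]%SET \in T &
      forall s t : {set 'I_N}, t \in T -> s \subset t -> s != finset.set0 ->
        s \in T].

Definition simplices (N : nat) (T : {set {set 'I_N}}) (d : nat) :
    {set {set 'I_N}} :=
  [set s in T | #|s| == d.+1]%SET.

(* Points of the realization are given by their barycentric coordinates. *)
Definition geometric_realization (R : realType) (N : nat)
    (T : {set {set 'I_N}}) : set 'rV[R]_N :=
  [set x : 'rV[R]_N | [/\ forall i, 0 <= x ord0 i, \sum_i x ord0 i = 1 &
                          [set i | x ord0 i != 0]%SET \in T]].

Definition triangulated_manifold (R : realType) (n : nat) (M : topologicalType)
    (N : nat) (T : {set {set 'I_N}}) : Prop :=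
  [/\ closed_manifold R n M, simplicial_complex T &
      homeomorphic (@geometric_realization R N T) [set: M]].

Definition edge_weight (R : realType) (N : nat) (T : {set {set 'I_N}})
    (Phi : {set 'I_N} -> R) : Prop :=
  forall e, e \in simplices T 1 -> 0 <= Phi e <= pi / 2.

Definition circle_packing_metrics (R : realType) (N : nat) : set 'rV[R]_N :=
  [set r : 'rV[R]_N | forall i, 0 < r ord0 i].

Definition circle_length (R : realType) (N : nat) (Phi : {set 'I_N} -> R)
    (r : 'rV[R]_N) (i j : 'I_N) : R :=
  Num.sqrt (r ord0 i ^+ 2 + r ord0 j ^+ 2
            + 2 * r ord0 i * r ord0 j * cos (Phi [set i; j]%SET)).

(* The angle between the sides of lengths [a] and [b] of the Euclidean triangle
   with side lengths [a], [b], [c]. *)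
Definition triangle_angle (R : realType) (a b c : R) : R :=
  acos ((a ^+ 2 + b ^+ 2 - c ^+ 2) / (2 * a * b)).

Definition circle_angle (R : realType) (N : nat) (Phi : {set 'I_N} -> R)
    (r : 'rV[R]_N) (i j k : 'I_N) : R :=
  let l := circle_length Phi r in triangle_angle (l i j) (l i k) (l j k).

(* Each triangle containing [i] is counted once, through its two other vertices
   listed in increasing order; likewise for tetrahedra below. *)
Definition gauss_curvature (R : realType) (N : nat) (T : {set {set 'I_N}})
    (Phi : {set 'I_N} -> R) (r : 'rV[R]_N) (i : 'I_N) : R :=
  2 * pi - \sum_(j < N) \sum_(k < N | (j < k)%N &&
                 ([set i; j; k]%SET \in simplices T 2)) circle_angle Phi r i j k.

Definition ball_length (R : realType) (N : nat) (r : 'rV[R]_N) (i j : 'I_N) : R :=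
  r ord0 i + r ord0 j.

Definition ball_Q (R : realType) (N : nat) (r : 'rV[R]_N) (i j k l : 'I_N) : R :=
  ((r ord0 i)^-1 + (r ord0 j)^-1 + (r ord0 k)^-1 + (r ord0 l)^-1) ^+ 2
  - 2 * ((r ord0 i ^+ 2)^-1 + (r ord0 j ^+ 2)^-1
         + (r ord0 k ^+ 2)^-1 + (r ord0 l ^+ 2)^-1).

Definition ball_packing_metrics (R : realType) (N : nat) (T : {set {set 'I_N}}) :
    set 'rV[R]_N :=
  [set r : 'rV[R]_N | (forall i, 0 < r ord0 i) /\
           forall i j k l, [set i; j; k; l]%SET \in simplices T 3 ->
             0 < ball_Q r i j k l].

Definition scale3 (R : realType) (t : R) (u : R * R * R) : R * R * R :=
  (t * u.1.1, t * u.1.2, t * u.2).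

Definition dot3 (R : realType) (u v : R * R * R) : R :=
  u.1.1 * v.1.1 + u.1.2 * v.1.2 + u.2 * v.2.

Definition norm3 (R : realType) (u : R * R * R) : R := Num.sqrt (dot3 u u).

Definition dist3 (R : realType) (u v : R * R * R) : R := norm3 (u - v).

Definition lebesgue3 (R : realType) (A : set (R * R * R)) : \bar R :=
  ((@lebesgue_measure R \x @lebesgue_measure R) \x @lebesgue_measure R)%E A.

(* Area of a subset of the unit sphere S^2, defined as usual through the volume
   of the cone over it inside the unit ball. *)
Definition sphere_area (R : realType) (E : set (R * R * R)) : R :=
  3 * fine (lebesgue3 [set x | exists t u, [/\ 0 <= t <= 1, E u & x = scale3 t u]]).

(* Solid angle at the vertex 0 of the tetrahedron with vertices 0, p, q, s: the
   area of the set of unit vectors pointing from 0 into the tetrahedron. *)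
Definition solid_angle (R : realType) (p q s : R * R * R) : R :=
  sphere_area [set u | norm3 u = 1 /\
    exists a b c, [/\ 0 <= a, 0 <= b, 0 <= c &
                      u = scale3 a p + scale3 b q + scale3 c s]].

(* The tetrahedron i, j, k, l with prescribed edge lengths, placed in R^3 with
   vertex i at the origin, j on the positive first axis, k in the upper half of
   the first coordinate plane and l in the upper half space: these are the
   positions of j, k and l. *)
Definition place_j (R : realType) (lij : R) : R * R * R := (lij, 0, 0).

Definition place_k (R : realType) (lij lik ljk : R) : R * R * R :=
  let x := (lij ^+ 2 + lik ^+ 2 - ljk ^+ 2) / (2 * lij) in
  (x, Num.sqrt (lik ^+ 2 - x ^+ 2), 0).

Definition place_l (R : realType) (lij lik lil ljk ljl lkl : R) : R * R * R :=
  let q := place_k lij lik ljk in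
  let x := (lij ^+ 2 + lil ^+ 2 - ljl ^+ 2) / (2 * lij) in
  let y := ((lik ^+ 2 + lil ^+ 2 - lkl ^+ 2) / 2 - q.1.1 * x) / q.1.2 in
  (x, y, Num.sqrt (lil ^+ 2 - x ^+ 2 - y ^+ 2)).

(* For a ball packing metric this tetrahedron is non-degenerate and has the
   prescribed edge lengths. *)
Lemma ball_tetrahedron (R : realType) (N : nat) (r : 'rV[R]_N) (i j k l : 'I_N) :
  (forall m, 0 < r ord0 m) -> 0 < ball_Q r i j k l ->
  let len := ball_length r in
  let p := place_j (len i j) in
  let q := place_k (len i j) (len i k) (len j k) in
  let s := place_l (len i j) (len i k) (len i l) (len j k) (len j l) (len k l) in
  [/\ 0 < p.1.1, 0 < q.1.2 & 0 < s.2] /\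
  [/\ norm3 p = len i j, norm3 q = len i k & norm3 s = len i l] /\
  [/\ dist3 p q = len j k, dist3 p s = len j l & dist3 q s = len k l].
Proof.
move=> r_gt0; rewrite /ball_Q /ball_length /place_l /place_k /place_j /=.
move: (r_gt0 i) (r_gt0 j) (r_gt0 k) (r_gt0 l).
move: (r ord0 i) (r ord0 j) (r ord0 k) (r ord0 l) => a b c d a0 b0 c0 d0 Q0.
set x := _ / (2 * (a + b)); set h := (a + c) ^+ 2 - x ^+ 2.
set u := _ / (2 * (a + b)); set g := _ / 2; set y := Num.sqrt h.
have ab0 : a + b != 0 by rewrite gt_eqF// addr_gt0.
have hE : h * (a + b) ^+ 2 = 4 * a * b * c * (a + b + c).
  by rewrite /h /x; field.
have h0 : 0 < h.
  rewrite -(@pmulr_lgt0 _ ((a + b) ^+ 2)) ?hE ?exprn_gt0 ?addr_gt0//.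
  by rewrite !mulr_gt0 ?addr_gt0.
have y0 : 0 < y by rewrite sqrtr_gt0.
have yy : y ^+ 2 = h by rewrite sqr_sqrtr ?ltW.
set v := _ / y; set w2 := _ - v ^+ 2.
have vy : v * y = g - x * u by rewrite /v divfK ?gt_eqF.
have wE : w2 * (h * (a + b) ^+ 2) =
    4 * (a * b * c * d) ^+ 2 *
    ((a^-1 + b^-1 + c^-1 + d^-1) ^+ 2
     - 2 * ((a ^+ 2)^-1 + (b ^+ 2)^-1 + (c ^+ 2)^-1 + (d ^+ 2)^-1)).
  transitivity (((a + d) ^+ 2 - u ^+ 2) * (h * (a + b) ^+ 2)
                - (v * y) ^+ 2 * (a + b) ^+ 2).
    by rewrite /w2 -yy; ring.
  rewrite vy hE /g /x /u; field.
  by rewrite ab0 !gt_eqF.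
have w0 : 0 < w2.
  rewrite -(@pmulr_lgt0 _ (h * (a + b) ^+ 2)) ?wE.
    by rewrite mulr_gt0// mulr_gt0// exprn_gt0// !mulr_gt0.
  by rewrite mulr_gt0// exprn_gt0// addr_gt0.
set w := Num.sqrt w2.
have ww : w ^+ 2 = w2 by rewrite sqr_sqrtr ?ltW.
have sqrtE (z t : R) : 0 < t -> z = t ^+ 2 -> Num.sqrt z = t.
  by move=> t0 ->; rewrite sqrtr_sqr gtr0_norm.
rewrite /dist3 /norm3 /dot3 /=; split; [split|split; split].
- exact: addr_gt0.
- exact: y0.
- by rewrite sqrtr_gt0.
- by apply: sqrtE; [exact: addr_gt0|ring].
- apply: sqrtE; [exact: addr_gt0|].
  by rewrite -!expr2 yy /h; ring.
- apply: sqrtE; [exact: addr_gt0|].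
  by rewrite -!expr2 ww /w2; ring.
- apply: sqrtE; [exact: addr_gt0|].
  transitivity ((a + b - x) ^+ 2 + y ^+ 2); first by ring.
  by rewrite yy /h /x; field.
- apply: sqrtE; [exact: addr_gt0|].
  transitivity ((a + b - u) ^+ 2 + v ^+ 2 + w ^+ 2); first by ring.
  by rewrite ww /w2 /u; field.
- apply: sqrtE; [exact: addr_gt0|].
  transitivity ((x - u) ^+ 2 + y ^+ 2 - 2 * (v * y) + v ^+ 2 + w ^+ 2).
    by ring.
  by rewrite ww yy vy /w2 /h /g; field.
Qed.

Definition ball_solid_angle (R : realType) (N : nat) (r : 'rV[R]_N)
    (i j k l : 'I_N) : R :=
  let len := ball_length r in
  solid_angle (place_j (len i j)) (place_k (len i j) (len i k) (len j k))
    (place_l (len i j) (len i k) (len i l) (len j k) (len j l) (len k l)).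

Definition scalar_curvature (R : realType) (N : nat) (T : {set {set 'I_N}})
    (r : 'rV[R]_N) (i : 'I_N) : R :=
  4 * pi - \sum_(j < N) \sum_(k < N | (j < k)%N) \sum_(l < N | (k < l)%N &&
                 ([set i; j; k; l]%SET \in simplices T 3)) ball_solid_angle r i j k l.

(* In the next two definitions only n = 2 and n = 3 are meaningful. *)
Definition conformal_class (R : realType) (n N : nat) (T : {set {set 'I_N}}) :
    set 'rV[R]_N :=
  if n == 2 then @circle_packing_metrics R N else @ball_packing_metrics R N T.

Definition curvature (R : realType) (n N : nat) (T : {set {set 'I_N}})
    (Phi : {set 'I_N} -> R) (r : 'rV[R]_N) (i : 'I_N) : R :=
  if n == 2 then gauss_curvature T Phi r i else scalar_curvature T r i.

Definition s_alpha (R : realType) (n N : nat) (T : {set {set 'I_N}})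
    (Phi : {set 'I_N} -> R) (alpha : R) (r : 'rV[R]_N) : R :=
  (\sum_i curvature n T Phi r i * r ord0 i `^ (n%:R - 2))
  / \sum_i r ord0 i `^ (alpha + n%:R - 2).

Definition flow_field (R : realType) (n N : nat) (T : {set {set 'I_N}})
    (Phi : {set 'I_N} -> R) (alpha beta : R) (r : 'rV[R]_N) (i : 'I_N) : R :=
  s_alpha n T Phi alpha r * r ord0 i `^ beta
  - curvature n T Phi r i * r ord0 i `^ (beta - alpha).

Definition constant_curvature_metric (R : realType) (n N : nat)
    (T : {set {set 'I_N}}) (Phi : {set 'I_N} -> R) (alpha : R)
    (r : 'rV[R]_N) : Prop :=
  conformal_class n T r /\
  forall i j, curvature n T Phi r i / r ord0 i `^ alpha
              = curvature n T Phi r j / r ord0 j `^ alpha.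

(* [d] is the derivative at [t] of the restriction of [f] to [I]; it is
   one-sided when [t] is an end point of [I]. *)
Definition derivative_within (R : realType) (I : set R) (f : R -> R) (t d : R) :
    Prop :=
  (f u - f t) / (u - t) @[u --> within (I `\ t) (nbhs t)] --> d.

Definition flow_solution (R : realType) (n N : nat) (T : {set {set 'I_N}})
    (Phi : {set 'I_N} -> R) (alpha beta : R) (I : set R) (r : R -> 'rV[R]_N) :
    Prop :=
  forall t, I t -> conformal_class n T (r t) /\
    forall i, derivative_within I (fun u => r u ord0 i) t
                (flow_field n T Phi alpha beta (r t) i).

(* Main.v *)
Require Import Defs.
From HB Require Import structures.
From mathcomp Require Import all_boot all_order all_algebra.
From mathcomp Require Import ring lra.
From mathcomp Require Import all_classical all_reals all_analysis.
From mathcomp Require Import measurable_realfun.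
Import Order.TTheory GRing.Theory Num.Theory.
Import numFieldNormedType.Exports.
Local Open Scope classical_set_scope.
Local Open Scope ring_scope.

(* Everything follows from the continuity of the curvatures on the open set
   [Omega]. For circle packings the three lengths of a face satisfy the strict
   triangle inequalities, so the angles are arccosines of values inside
   [(-1, 1)]. For ball packings the solid angle is, up to the factor 3, the volume
   of a sector of the unit ball bounded by one fixed and two oblique planes whose
   slopes depend continuously on [r]; moving the slopes by at most [e] changes the
   sector only inside two slabs of volume [O(e)]. Local existence is then Peano's
   theorem, and if [r(t)] converges to [r*] then [r(t + 1) - r(t)] tends both to 0
   and, by the mean value theorem, to the flow field at [r*], which makes [r*] a
   critical point. *)

(** * Peano's theorem *)

Section Euler.
Context {R : realType} {V : normedModType R}.
Variables (F : V -> V) (x0 : V) (h : R).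
Hypothesis h_ge0 : 0 <= h.

Definition euler (k : nat) : V := iter k (fun y => y + h *: F y) x0.

(** The increment over [m] steps telescopes, and each step departs from [h *: v] by at most [h * e].
    With [v = 0] this bounds displacements; with [v] the field at a limit point it gives the
    derivative estimate. *)
Lemma euler_drift (v : V) (e : R) (k m : nat) :
  (forall j, (j < m)%N -> `|F (euler (k + j)) - v| <= e) ->
  `|euler (k + m) - euler k - (m%:R * h) *: v| <= m%:R * h * e.
Proof.
elim: m => [|m IH] H.
  by rewrite addn0 subrr mul0r scale0r subr0 normr0 mul0r.
rewrite addnS /= -natr1.
have -> : euler (k + m) + h *: F (euler (k + m)) - euler k - ((m%:R + 1) * h) *: v
   = (euler (k + m) - euler k - (m%:R * h) *: v) + h *: (F (euler (k + m)) - v).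
  by rewrite mulrDl mul1r scalerDl scalerBr opprD [_ + _ - euler k]addrAC addrACA.
apply: le_trans (ler_normD _ _) _.
have -> : (m%:R + 1) * h * e = m%:R * h * e + h * e by ring.
apply: lerD; first by apply: IH => j jm; apply: H; rewrite ltnS ltnW.
by rewrite normrZ ger0_norm// ler_wpM2l// H.
Qed.

(** By induction, an iterate still in the ball moves by at most [h * L] in the next step, so the
    polygon cannot leave before the time bound is exhausted. *)
Lemma euler_ball (L rho : R) (k : nat) :
  (forall y, `|y - x0| <= rho -> `|F y| <= L) -> 0 <= L ->
  k%:R * h * L <= rho -> `|euler k - x0| <= rho.
Proof.
move=> FL L0 kr.
suff : `|euler k - x0| <= k%:R * h * L by move/le_trans; apply.
elim: k kr => [|k IH] kr; first by rewrite /= subrr normr0 !mul0r.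
have kr' : k%:R * h * L <= rho.
  by apply: le_trans kr; rewrite -natr1 !mulrDl mul1r lerDl mulr_ge0.
have {}IH := IH kr'.
rewrite /= -natr1 addrAC !mulrDl mul1r.
apply: le_trans (ler_normD _ _) _; apply: lerD => //.
rewrite normrZ ger0_norm// ler_wpM2l// FL//.
exact: le_trans kr'.
Qed.

End Euler.

(** For each set [A], [G] contains the preimage of [A] or its complement. If [A] belongs to a finer
    proper filter, the second case would put both [A] and its complement there. *)
Lemma ultra_fmap {T U : Type} (f : T -> U) (G : set_system T) :
  UltraFilter G -> UltraFilter (f @ G).
Proof.
move=> UG; split; first exact: fmap_proper_filter.
move=> H HP GH; rewrite predeqE => A; split; last exact: GH.
move=> HA; have [//|GnA] := in_ultra_setVsetC (f @^-1` A) UG.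
have HnA : H (~` A) by exact: GH.
by have [x []] := filter_ex (filterI HA HnA).
Qed.

Lemma truncn_grid {R : realType} (h t : R) : 0 < h -> 0 <= t ->
  (Num.trunc (t / h))%:R * h <= t < (Num.trunc (t / h))%:R * h + h.
Proof.
move=> h0 t0.
have /truncn_itv : 0 <= t / h by rewrite divr_ge0// ltW.
by rewrite ler_pdivlMr// ltr_pdivrMr// -natr1 mulrDl mul1r.
Qed.

(* Peano's theorem: Euler step functions of mesh [1/(n+1)], evaluated at each
   time along a fixed ultrafilter on the meshes, converge pointwise by
   compactness; only continuity of [F] is needed to differentiate the limit. *)
Lemma peano_local_existence {R : realType} {N : nat} (F : 'rV[R]_N -> 'rV[R]_N)
    (D : set 'rV[R]_N) (x0 : 'rV[R]_N) :
  open D -> (forall x, D x -> {for x, continuous F}) -> D x0 ->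
  exists (eps : R) (x : R -> 'rV[R]_N), [/\ 0 < eps, x 0 = x0 &
    forall t, 0 <= t < eps -> D (x t) /\
      forall e, 0 < e -> exists2 d, 0 < d &
        forall u, 0 <= u < eps -> `|u - t| < d ->
          `|x u - x t - (u - t) *: F (x t)| <= `|u - t| * e].
Proof.
move=> oD cF Dx0.
(* The added 1 keeps [L] positive and leaves room for the variation of [F] near [x0]. *)
pose L := `|F x0| + 1.
have L0 : 0 < L by rewrite ltr_wpDl.
have [rho rho0 Hrho] : exists2 rho : R, 0 < rho &
    forall y, `|y - x0| <= rho -> D y /\ `|F y| <= L.
  have cF0 : F y @[y --> x0] --> F x0 := cF _ Dx0.
  have : \forall y \near x0, D y /\ `|F y| <= L.
    near=> y; split; first by near: y; exact: open_nbhs_nbhs.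
    have : `|F x0 - F y| < 1 by near: y; move/cvgrPdist_lt: cF0; apply.
    rewrite distrC => /ltW; rewrite /L.
    have := ler_normD (F x0) (F y - F x0); rewrite subrKC => /le_trans + H; apply.
    by rewrite lerD2l.
  move=> /nbhs_ballP[d /= d0 Hd]; exists (d / 2); first by rewrite divr_gt0.
  move=> y yd; apply: Hd; rewrite -ball_normE /= distrC.
  by apply: le_lt_trans yd _; rewrite ltr_pdivrMr// mulr_natr mulr2n ltrDl.
have FL y : `|y - x0| <= rho -> `|F y| <= L by move/Hrho=> [].
(* At speed at most [L], leaving the ball of radius [rho] takes at least this time. *)
pose eps := rho / L; have eps0 : 0 < eps by rewrite divr_gt0.
pose h (n : nat) : R := n.+1%:R^-1.
have h0 n : 0 < h n by rewrite invr_gt0.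
have [U [UU oU]] := @ultraFilterLemma nat _ eventually_filter.
have PU : ProperFilter U := @ultra_proper _ _ UU.
have hU : h n @[n --> U] --> (0 : R).
  move=> A A0; apply: oU; exact: cvg_harmonic A0.
pose Y n k := euler F x0 (h n) k.
have Yball n k : k%:R * h n < eps -> `|Y n k - x0| <= rho.
  move=> khn; apply: (@euler_ball _ _ F x0 (h n) (ltW (h0 n)) L rho k FL (ltW L0)).
  by rewrite -ler_pdivlMr// ltW.
pose xn n (t : R) := Y n (Num.trunc (t / h n)).
have xnball n t : 0 <= t < eps -> `|xn n t - x0| <= rho.
  move=> /andP[t0 te]; apply: Yball; apply: le_lt_trans te.
  by have /andP[] := truncn_grid (h n) t (h0 n) t0.
have Kc : compact [set y : 'rV[R]_N | `|y - x0| <= rho].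
  rewrite (_ : [set y | _] = closed_ball x0 rho); last first.
    by rewrite closed_ballE//; apply/seteqP; split => y /=; rewrite distrC.
  apply: bounded_closed_compact; last exact: closed_ball_closed.
  rewrite closed_ballE//; exists (`|x0| + rho); split; first exact: num_real.
  move=> M /ltW rM y /= yr; apply: le_trans rM.
  rewrite -[y](subrKC x0); apply: le_trans (ler_normD _ _) _.
  by rewrite lerD2l distrC.
(* For each [t] the pushed-forward ultrafilter lives on a compact ball, hence converges; no
   equicontinuity or extraction of a subsequence is involved. *)
pose x t := lim (xn n t @[n --> U]).
have xcvg t : 0 <= t < eps -> xn n t @[n --> U] --> x t /\ `|x t - x0| <= rho.
  move=> tI; move: Kc; rewrite compact_ultra => /(_ _ (ultra_fmap (xn ^~ t) U UU)).
  case.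
    by rewrite /fmap /=; apply: filterE => n /=; apply: xnball.
  move=> p [/= pr Hp]; have -> : x t = p by apply: cvg_lim.
  by split.
exists eps, x; split => //.
  apply: cvg_lim => //; apply: cvg_near_cst; apply: filterE => n.
  by rewrite /xn mul0r truncn0.
move=> t tI; have [xt tr] := xcvg t tI.
have [Dxt _] := Hrho _ tr.
split=> // e e0.
have [d d0 Hd] : exists2 d, 0 < d & forall y, `|y - x t| < d -> `|F y - F (x t)| <= e.
  have cFt : F y @[y --> x t] --> F (x t) := cF _ Dxt.
  have : \forall y \near x t, `|F y - F (x t)| <= e.
    near=> y; rewrite distrC; apply: ltW; near: y.
    by move/cvgrPdist_lt: cFt; apply.
  move=> /nbhs_ballP[d /= d0 Hd]; exists d => // y yd; apply: Hd.
  by rewrite -ball_normE /= distrC.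
set v := F (x t) in Hd *.
(* Budget for staying within [d] of [x t]: less than [d / 4] for the motion between the two times,
   less than [d / 4] for one grid step of rounding, and less than [d / 4] for the distance from the
   approximation to [x t]. *)
exists (d / 4 / L); first by rewrite !divr_gt0.
move=> u uI utd; have [xu _] := xcvg u uI.
have utL : `|u - t| * L < d / 4 by rewrite -ltr_pdivlMr.
(* Stated for ordered times [a <= b], with either end close to [x t], so that it covers both
   [t <= u] and [u <= t]. *)
have key a b n : 0 <= a -> a <= b -> b < eps -> (b - a) * L < d / 4 ->
    h n * L < d / 4 -> (`|xn n a - x t| < d / 4 \/ `|xn n b - x t| < d / 4) ->
    `|xn n b - xn n a - (b - a) *: v| <= (b - a) * e + h n * (e + `|v|).
  move=> a0 ab be baL hL xab.
  have /andP[ka1 ka2] := truncn_grid (h n) a (h0 n) a0.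
  have /andP[kb1 kb2] := truncn_grid (h n) b (h0 n) (le_trans a0 ab).
  have kab : (Num.trunc (a / h n) <= Num.trunc (b / h n))%N.
    by apply: le_truncn; rewrite ler_pM2r ?invr_gt0.
  rewrite /xn in xab *.
  move: (Num.trunc (a / h n)) (Num.trunc (b / h n)) ka1 ka2 kb1 kb2 kab xab.
  move=> k k' ka1 ka2 kb1 kb2 /subnKC; move: (k' - k)%N => m mE; subst k'.
  move=> xab; have hn0 := h0 n; move: ka1 ka2 kb1 kb2.
  rewrite natrD mulrDl => ka1 ka2 kb1 kb2.
  have YL q : (q <= k + m)%N -> `|F (Y n q)| <= L.
    move=> qkm; apply/FL/Yball/(le_lt_trans _ be); apply: le_trans kb1.
    by rewrite -mulrDl -natrD ler_wpM2r ?ler_nat// ltW.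
  have Yd q i : (q + i <= k + m)%N -> `|Y n (q + i) - Y n q| <= i%:R * h n * L.
    move=> qi; have := euler_drift F x0 (h n) (ltW hn0) 0 L q i.
    rewrite scaler0 subr0; apply=> l li; rewrite subr0; apply: YL.
    by apply: leq_trans qi; rewrite leq_add2l ltnW.
  have mh : m%:R * h n * L < d / 2.
    have : m%:R * h n * L <= (b - a + h n) * L by rewrite ler_wpM2r ?ltW//; lra.
    rewrite mulrDl => /le_lt_trans; apply; lra.
  have ihm i : (i <= m)%N -> i%:R * h n * L <= m%:R * h n * L.
    by move=> im; rewrite !ler_wpM2r ?ler_nat// ltW.
  (* Every intermediate iterate is compared with the first or the last one, whichever is known to be
     near [x t]. *)
  have Hj j : (j < m)%N -> `|F (Y n (k + j)) - v| <= e.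
    move=> jm; apply: Hd; case: xab => xab.
      rewrite -(subrKA (Y n k)); apply: le_lt_trans (ler_normD _ _) _.
      have := Yd k j; rewrite leq_add2l ltnW// => /(_ isT).
      have := ihm j (ltnW jm); lra.
    rewrite -(subrKA (Y n (k + m))); apply: le_lt_trans (ler_normD _ _) _.
    have kjm : (k + j + (m - j))%N = (k + m)%N by rewrite -addnA (subnKC (ltnW jm)).
    have : `|Y n (k + j)%N - Y n (k + m)%N| <= (m - j)%:R * h n * L.
      by rewrite distrC -kjm; apply: Yd; rewrite kjm.
    have := ihm _ (leq_subr j m); lra.
  have := euler_drift F x0 (h n) (ltW (h0 n)) v e k m Hj.
  rewrite -/(Y n (k + m)) -/(Y n k) => H.
  rewrite -(subrKA ((m%:R * h n) *: v)) -scalerBl.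
  apply: le_trans (ler_normD _ _) _; rewrite normrZ.
  (* Both times are rounded down to the grid, so the elapsed time is off by at most one mesh width.
     This is the source of the error [h n * (e + |v|)], which vanishes in the limit. *)
  have mb : `|m%:R * h n - (b - a)| <= h n by rewrite ler_norml; apply/andP; split; lra.
  have := ler_wpM2r (normr_ge0 v) mb.
  have : m%:R * h n * e <= (b - a + h n) * e by rewrite ler_wpM2r ?ltW//; lra.
  lra.
have c1 : `|xn n u - xn n t - (u - t) *: v| @[n --> U] --> `|x u - x t - (u - t) *: v|.
  by apply: cvg_norm; apply: cvgB; [exact: cvgB|exact: cvg_cst].
have c2 : `|u - t| * e + h n * (e + `|v|) @[n --> U] --> `|u - t| * e.
  rewrite -[X in _ --> X]addr0 -(mul0r (e + `|v|)).
  by apply: cvgD; [exact: cvg_cst|apply: cvgMl].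
apply: (ler_cvg_to c1 c2).
near=> n.
have hL : h n * L < d / 4.
  rewrite -ltr_pdivlMr// -[h n]ger0_norm ?ltW// -[h n]opprK normrN -sub0r.
  near: n; by move/cvgrPdist_lt: hU; apply; rewrite !divr_gt0.
have xntd : `|xn n t - x t| < d / 4.
  rewrite distrC; near: n; move/cvgrPdist_lt: xt; apply; exact: divr_gt0.
case: (leP t u) => [tu|/ltW ut].
  move: utL; rewrite ger0_norm ?subr_ge0// => utL.
  by apply: key => //; [case/andP: tI|case/andP: uI|left].
move: utL; rewrite distrC ger0_norm ?subr_ge0// => utL.
rewrite (_ : xn n u - _ - _ = - (xn n t - xn n u - (t - u) *: v)) ?normrN; last first.
  by rewrite opprB opprB [RHS]addrC -scaleNr opprB.
by apply: key => //; [case/andP: uI|case/andP: tI|right].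
Unshelve. all: by end_near.
Qed.

(** * Volume of spherical sectors *)

Section SolidAngle.
Context {R : realType}.
Local Notation mu := (@lebesgue_measure R).

(* The cone spanned by three vectors in triangular position, cut by the unit
   ball; [m], [u], [v] are the slopes of its two oblique faces. *)
Definition cone_sector (m u v : R) : set (R * R * R) :=
  [set x | [/\ dot3 x x <= 1, 0 <= x.2, m * x.2 <= x.1.2 &
               u * x.1.2 + v * x.2 <= x.1.1]].

(** The system [x = a p + b q + c s] is triangular with positive diagonal, so back substitution
    turns nonnegativity of [c], [b], [a] into the three linear inequalities of [cone_sector]. *)
Lemma cone_sectorE (p q s : R * R * R) :
  0 < p.1.1 -> p.1.2 = 0 -> p.2 = 0 -> 0 < q.1.2 -> q.2 = 0 -> 0 < s.2 ->
  [set x | exists t u, [/\ 0 <= t <= 1,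
     (norm3 u = 1 /\ exists a b c, [/\ 0 <= a, 0 <= b, 0 <= c &
        u = scale3 a p + scale3 b q + scale3 c s]) & x = scale3 t u]] =
  cone_sector (s.1.2 / s.2) (q.1.1 / q.1.2)
    ((s.1.1 - q.1.1 / q.1.2 * s.1.2) / s.2).
Proof.
case: p => [[p1 p2] p3]; case: q => [[q1 q2] q3]; case: s => [[s1 s2] s3] /=.
move=> p0 -> -> q0 -> s0.
have q_neq0 : q2 != 0 by rewrite gt_eqF.
have s_neq0 : s3 != 0 by rewrite gt_eqF.
have p_neq0 : p1 != 0 by rewrite gt_eqF.
have norm1 (u : R * R * R) : norm3 u = 1 -> dot3 u u = 1.
  move=> /(congr1 (fun x => x ^+ 2)); rewrite /norm3 sqr_sqrtr ?expr1n//.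
  by rewrite /dot3 -!expr2 !addr_ge0 ?sqr_ge0.
have eq3 (u w : R * R * R) : u.1.1 = w.1.1 -> u.1.2 = w.1.2 -> u.2 = w.2 -> u = w.
  by case: u w => [[? ?] ?] [[? ?] ?] /= -> -> ->.
apply/seteqP; split => [x [t [u [/andP[t0 t1] [/norm1 u1 [a [b [c [a0 b0 c0 uE]]]]] ->]]]|].
  have uE1 : u.1.1 = a * p1 + b * q1 + c * s1 by rewrite uE.
  have uE2 : u.1.2 = b * q2 + c * s2 by rewrite uE /= mulr0 add0r.
  have uE3 : u.2 = c * s3 by rewrite uE /= !mulr0 !add0r.
  rewrite /cone_sector /=; split.
  - have -> : dot3 (scale3 t u) (scale3 t u) = t ^+ 2 * dot3 u u.
      by rewrite /dot3 /scale3 /=; ring.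
    by rewrite u1 mulr1 expr_le1.
  - by rewrite uE3 !mulr_ge0// ltW.
  - rewrite uE2 uE3 -subr_ge0.
    rewrite (_ : _ - _ = t * (b * q2)); last by field.
    by rewrite !mulr_ge0// ltW.
  - rewrite uE1 uE2 uE3 -subr_ge0.
    rewrite (_ : _ - _ = t * (a * p1)); last by field; rewrite q_neq0 s_neq0.
    by rewrite !mulr_ge0// ltW.
move=> [[x1 x2] x3]; rewrite /cone_sector /= => -[x1' x3_ge0 x2_ge0 x1_ge0].
have [x0|x0] := eqVneq (dot3 (x1, x2, x3) (x1, x2, x3)) 0.
  have [-> -> ->] : [/\ x1 = 0, x2 = 0 & x3 = 0].
    move: x0; rewrite /dot3 /= -!expr2 => /eqP.
    rewrite !paddr_eq0 ?addr_ge0 ?sqr_ge0// !sqrf_eq0.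
    by move=> /andP[/andP[/eqP-> /eqP->] /eqP->].
  (* The apex is reached with factor 0 from any unit vector of the cone; here the direction of [p]
     is taken. *)
  exists 0, (1, 0, 0); split; [by rewrite lexx ler01| |].
    split; first by rewrite /norm3 /dot3 /= !mul0r !addr0 mulr1 sqrtr1.
    exists p1^-1, 0, 0; split; rewrite ?invr_ge0 ?(ltW p0)//.
    by refine (eq3 _ _ _ _ _); rewrite /= ?mulVf//; ring.
  by refine (eq3 _ _ _ _ _); rewrite /=; ring.
have d0 : 0 < dot3 (x1, x2, x3) (x1, x2, x3).
  by rewrite lt_def x0 /dot3 /= -!expr2 !addr_ge0 ?sqr_ge0.
pose n := norm3 (x1, x2, x3).
have n0 : 0 < n by rewrite sqrtr_gt0.
have n_neq0 : n != 0 by rewrite gt_eqF.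
have nn : n ^+ 2 = x1 * x1 + x2 * x2 + x3 * x3 by rewrite sqr_sqrtr ?ltW.
exists n, (x1 / n, x2 / n, x3 / n); split.
- rewrite (ltW n0) /= -(@ler_pXn2r _ 2) ?nnegrE ?ler01 ?(ltW n0)//.
  by rewrite expr1n nn.
- split.
    rewrite /norm3 /dot3 /=.
    rewrite (_ : _ + _ = (x1 * x1 + x2 * x2 + x3 * x3) / n ^+ 2); last by field.
    by rewrite -nn divff ?sqrtr1// expf_neq0.
  (* The coefficients from back substitution, divided by the norm [n]. *)
  exists ((x1 - (q1 / q2 * x2 + (s1 - q1 / q2 * s2) / s3 * x3)) / p1 / n),
    ((x2 - s2 / s3 * x3) / q2 / n), (x3 / s3 / n).
  split; rewrite ?divr_ge0 ?subr_ge0 ?(ltW n0) ?(ltW p0) ?(ltW q0) ?(ltW s0)//.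
  refine (eq3 _ _ _ _ _) => /=; field; rewrite ?n_neq0 ?s_neq0 ?q_neq0 ?p_neq0//.
- by refine (eq3 _ _ _ _ _) => /=; field.
Qed.

Lemma solid_angleE (p q s : R * R * R) :
  0 < p.1.1 -> p.1.2 = 0 -> p.2 = 0 -> 0 < q.1.2 -> q.2 = 0 -> 0 < s.2 ->
  solid_angle p q s = 3 * fine (lebesgue3 (cone_sector (s.1.2 / s.2) (q.1.1 / q.1.2)
    ((s.1.1 - q.1.1 / q.1.2 * s.1.2) / s.2))).
Proof. by move=> *; rewrite /solid_angle /sphere_area -(cone_sectorE p). Qed.

(** * Measurability and volume estimates by slicing *)

Lemma measurable_le_fun (d : measure_display) (T : measurableType d) (f g : T -> R) :
  measurable_fun setT f -> measurable_fun setT g ->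
  measurable [set x | f x <= g x].
Proof.
move=> mf mg; have := measurable_fun_ler mf mg.
move=> /(_ measurableT [set true] I); rewrite setTI.
by rewrite (_ : _ @^-1` _ = [set x | f x <= g x])//; apply/seteqP.
Qed.

Lemma measurable_abs_le (d : measure_display) (T : measurableType d) (f : T -> R)
    (e : R) :
  measurable_fun setT f -> measurable [set x | `|f x| <= e].
Proof.
by move=> mf; apply: measurable_le_fun => //; apply: measurableT_comp.
Qed.

(** Tonelli: the section measures are at most [e] on [D] and vanish off [D]. *)
Lemma product_measure_section_le (d1 d2 : measure_display)
    (T1 : measurableType d1) (T2 : measurableType d2)
    (m1 : {sigma_finite_measure set T1 -> \bar R})
    (m2 : {sigma_finite_measure set T2 -> \bar R})
    (A : set (T1 * T2)) (D : set T2) (e : R) :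
  measurable A -> measurable D -> 0 <= e ->
  (forall x y, A (x, y) -> D y) ->
  (forall y, (m1 (ysection A y) <= e%:E)%E) ->
  ((m1 \x m2) A <= e%:E * m2 D)%E.
Proof.
move=> mA mD e0 AD Ae.
(* Uniqueness of the product measure allows the other order of integration, which slices at a fixed
   second coordinate. *)
have -> : (m1 \x m2)%E A = (m1 \x^ m2)%E A.
  by apply: product_measure_unique => // B C mB mC /=; rewrite product_measure2E.
rewrite /product_measure2.
have -> : (e%:E * m2 D = \int[m2]_y (e%:E * (\1_D y)%:E))%E.
  rewrite ge0_integralZl ?integral_indic ?setIT ?lee_fin//.
  by apply: measurableT_comp.
apply: ge0_le_integral => //.
- exact: measurable_fun_ysection.
- by apply: emeasurable_funM => //; exact: measurableT_comp.
- move=> y _ /=; rewrite indicE; case: (boolP (y \in D)) => yD.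
    by rewrite mule1.
  rewrite (_ : ysection A y = set0) ?measure0 ?mule0//.
  apply/seteqP; split => // x /ysectionP /AD Dy.
  by move: yD; rewrite notin_setE.
Qed.

Lemma lebesgue_measure_abs_le (c e : R) : 0 <= e ->
  mu [set z | `|z - c| <= e] = (2 * e)%:E.
Proof.
move=> e0; rewrite (_ : [set z | _] = [set` `[c - e, c + e]]); last first.
  apply/seteqP; split => z /=; rewrite in_itv /= ler_distl;
  by move=> /andP[? ?]; apply/andP; split; lra.
rewrite lebesgue_measure_itv /= lte_fin; case: ifPn => [_|].
  by rewrite -EFinD; congr EFin; ring.
by rewrite -leNgt => ?; congr EFin; lra.
Qed.

(* The library's sigma-finite structure on [\x] is shadowed by the one for
   subprobabilities, so it is declared again on a named copy. *)
Definition lebesgue2 : set (measurableTypeR R * measurableTypeR R) -> \bar R :=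
  (mu \x mu)%E.

HB.instance Definition _ := Measure.on lebesgue2.

(** The squares of half-side [n] exhaust the plane. *)
Lemma lebesgue2_sigma_finite : sigma_finite setT lebesgue2.
Proof.
pose I (n : nat) := [set z : R | `|z| <= n%:R].
have mI n : measurable (I n : set (measurableTypeR R)) by exact: measurable_abs_le.
have muI n : mu (I n) = (2 * n%:R)%:E.
  rewrite -(lebesgue_measure_abs_le 0)//; congr (mu _).
  by apply/seteqP; split => z; rewrite /I /= subr0.
exists (fun n => I n `*` I n).
  apply/esym; rewrite -subTset => -[x y] _.
  exists (Num.trunc (Num.max `|x| `|y|)).+1 => //; split; rewrite /I /=;
    apply/ltW/(le_lt_trans _ (truncnS_gt _)); rewrite le_max lexx ?orbT//.
move=> n; split; first exact: measurableX.
rewrite [X in (X < _)%E]product_measure1E//.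
have -> : (mu (I n) * mu (I n))%E = (2 * n%:R * (2 * n%:R))%:E by rewrite !muI -EFinM.
exact: ltry.
Qed.

HB.instance Definition _ :=
  @Measure_isSigmaFinite.Build _ _ R lebesgue2 lebesgue2_sigma_finite.

Let m11 : measurable_fun setT (fun x : R * R * R => x.1.1).
Proof. exact: measurableT_comp measurable_fst measurable_fst. Qed.

Let m12 : measurable_fun setT (fun x : R * R * R => x.1.2).
Proof. exact: measurableT_comp measurable_snd measurable_fst. Qed.

Let m2 : measurable_fun setT (fun x : R * R * R => x.2).
Proof. exact: measurable_snd. Qed.

Let mlin (u v : R) : measurable_fun setT (fun x : R * R * R => u * x.1.2 + v * x.2).
Proof.
by apply: measurable_funD; apply: measurable_funM.
Qed.

Lemma measurable_cone_sector (m u v : R) : measurable (cone_sector m u v).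
Proof.
rewrite (_ : cone_sector m u v =
  [set x | dot3 x x <= 1] `&` [set x | 0 <= x.2] `&` [set x | m * x.2 <= x.1.2]
  `&` [set x | u * x.1.2 + v * x.2 <= x.1.1]); last first.
  by apply/seteqP; split => x; [case=> ? ? ? ?|case=> [[[? ?] ?] ?]].
apply: measurableI; [apply: measurableI; [apply: measurableI|]|];
  apply: measurable_le_fun => //.
  by apply: measurable_funD;
    [apply: measurable_funD|];
    apply: measurable_funM.
by apply: measurable_funM.
Qed.

(** The two slabs surround the oblique faces of the sector. The thickness is measured along one
    coordinate axis, the first for [slab1] and the second for [slab2], so that slices in that
    direction are intervals of length at most [2 * e]. *)
Definition slab2 (m e : R) : set (R * R * R) :=
  [set x | [/\ `|x.1.1| <= 1, `|x.2| <= 1 & `|x.1.2 - m * x.2| <= e]].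

Definition slab1 (u v e : R) : set (R * R * R) :=
  [set x | [/\ `|x.1.2| <= 1, `|x.2| <= 1 & `|x.1.1 - (u * x.1.2 + v * x.2)| <= e]].

Lemma measurable_slab2 (m e : R) : measurable (slab2 m e).
Proof.
rewrite (_ : slab2 m e = [set x | `|x.1.1| <= 1] `&` [set x | `|x.2| <= 1]
   `&` [set x | `|x.1.2 - m * x.2| <= e]); last first.
  by apply/seteqP; split => x; [case=> ? ? ?|case=> [[? ?] ?]].
apply: measurableI; [apply: measurableI|]; apply: measurable_abs_le => //.
apply: measurable_funB => //.
by apply: measurable_funM.
Qed.

Lemma measurable_slab1 (u v e : R) : measurable (slab1 u v e).
Proof.
rewrite (_ : slab1 u v e = [set x | `|x.1.2| <= 1] `&` [set x | `|x.2| <= 1]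
   `&` [set x | `|x.1.1 - (u * x.1.2 + v * x.2)| <= e]); last first.
  by apply/seteqP; split => x; [case=> ? ? ?|case=> [[? ?] ?]].
apply: measurableI; [apply: measurableI|]; apply: measurable_abs_le => //.
by apply: measurable_funB.
Qed.

Let abs_le1 : measurable [set z : R | `|z| <= 1].
Proof. exact: measurable_abs_le. Qed.

Let mu_abs_le1 : mu [set z : R | `|z| <= 1] = 2%:E.
Proof.
rewrite (_ : [set z : R | _] = [set z | `|z - 0| <= 1]); last first.
  by apply/seteqP; split => z /=; rewrite subr0.
by rewrite lebesgue_measure_abs_le// mulr1.
Qed.

(** At a fixed third coordinate the slice lies in a rectangle of sides [2] and [2 * e]; the third
    coordinate ranges over a set of length 2. *)
Lemma lebesgue3_slab2 (m e : R) : 0 <= e -> (lebesgue3 (slab2 m e) <= (8 * e)%:E)%E.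
Proof.
move=> e0; rewrite (_ : (8 * e)%:E = (4 * e)%:E * mu [set z : R | `|z| <= 1]%R)%E; last first.
  by rewrite mu_abs_le1 -EFinM; congr EFin; ring.
rewrite /lebesgue3; apply: (@product_measure_section_le _ _
  (measurableTypeR R * measurableTypeR R)%type (measurableTypeR R) lebesgue2 mu
  _ _ (4 * e)).
- exact: measurable_slab2.
- exact: abs_le1.
- by rewrite mulr_ge0.
- by move=> x y [].
move=> y; apply: (@le_trans _ _ ((mu \x mu)%E
   ([set z : R | `|z| <= 1] `*` [set z : R | `|z - m * y| <= e]))).
  apply: le_measure; rewrite ?inE.
  - by apply: measurable_ysection; exact: measurable_slab2.
  - apply: measurableX => //; apply: measurable_abs_le.
    exact: measurable_funB.
  - by move=> [x1 x2] /ysectionP[/= ? ? ?]; split.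
rewrite product_measure1E//; last first.
  by apply: measurable_abs_le; exact: measurable_funB.
rewrite [X in (X * _)%E]mu_abs_le1 [X in (_ * X)%E]lebesgue_measure_abs_le//.
by rewrite -EFinM lee_fin; lra.
Qed.

(** The centre of the thin interval depends on both other coordinates, so slices are not contained
    in a thin rectangle; slicing is applied twice instead. *)
Lemma lebesgue3_slab1 (u v e : R) : 0 <= e -> (lebesgue3 (slab1 u v e) <= (8 * e)%:E)%E.
Proof.
move=> e0; rewrite (_ : (8 * e)%:E = (4 * e)%:E * mu [set z : R | `|z| <= 1]%R)%E; last first.
  by rewrite mu_abs_le1 -EFinM; congr EFin; ring.
rewrite /lebesgue3; apply: (@product_measure_section_le _ _
  (measurableTypeR R * measurableTypeR R)%type (measurableTypeR R) lebesgue2 mu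
  _ _ (4 * e)).
- exact: measurable_slab1.
- exact: abs_le1.
- by rewrite mulr_ge0.
- by move=> x y [].
move=> y; rewrite (_ : (4 * e)%:E = (2 * e)%:E * mu [set z : R | `|z| <= 1]%R)%E; last first.
  by rewrite mu_abs_le1 -EFinM; congr EFin; ring.
apply: (@product_measure_section_le _ _ (measurableTypeR R) (measurableTypeR R)
  mu mu _ _ (2 * e)).
- by apply: measurable_ysection; exact: measurable_slab1.
- exact: abs_le1.
- by rewrite mulr_ge0.
- by move=> x z /ysectionP[].
move=> z; rewrite -(lebesgue_measure_abs_le (u * z + v * y))//.
apply: le_measure; rewrite ?inE.
- by do 2 apply: measurable_ysection; exact: measurable_slab1.
- by apply: measurable_abs_le; exact: measurable_funB.
- by move=> x /ysectionP/ysectionP[].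
Qed.

Let dot3_le1 (x : R * R * R) : dot3 x x <= 1 ->
  [/\ `|x.1.1| <= 1, `|x.1.2| <= 1 & `|x.2| <= 1].
Proof.
have sq (z : R) : z ^+ 2 <= 1 -> `|z| <= 1.
  by rewrite -real_normK ?num_real// expr_le1.
rewrite /dot3 -!expr2 => x1.
have := sqr_ge0 x.1.1; have := sqr_ge0 x.1.2; have := sqr_ge0 x.2.
by move=> ? ? ?; split; apply: sq; lra.
Qed.

(** The unit ball lies in the cube [slab2 0 1]. Finiteness ensures that [fine] loses nothing. *)
Lemma lebesgue3_cone_sector_fin (m u v : R) :
  lebesgue3 (cone_sector m u v) \is a fin_num.
Proof.
have box : (lebesgue3 (cone_sector m u v) <= lebesgue3 (slab2 0 1))%E.
  apply: le_measure; rewrite ?inE.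
  - exact: measurable_cone_sector.
  - exact: measurable_slab2.
  - by move=> x [/dot3_le1[? ? ?] _ _ _]; split; rewrite ?mul0r ?subr0.
rewrite ge0_fin_numE; last exact: measure_ge0.
by apply: le_lt_trans box (le_lt_trans (lebesgue3_slab2 _ _ _) (ltry _)).
Qed.

(** In the unit ball all coordinates are at most 1 in absolute value, so the right-hand side of an
    oblique inequality moves by at most [e] for the slope [m] and [2 * e] for the pair [u], [v]. A
    point violating an old inequality is thus within that distance of its face. *)
Lemma cone_sector_perturb (m u v m' u' v' e : R) :
  `|m - m'| <= e -> `|u - u'| <= e -> `|v - v'| <= e ->
  cone_sector m' u' v' `<=`
    cone_sector m u v `|` slab2 m e `|` slab1 u v (2 * e).
Proof.
move=> me ue ve x [x1 x3 x2 x0]; have [a1 a2 a3] := dot3_le1 _ x1.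
have M (a b c : R) : `|a - b| <= e -> `|c| <= 1 -> `|(a - b) * c| <= e.
  move=> ab c1; rewrite normrM -[leRHS]mulr1; apply: ler_pM => //.
have := M _ _ _ me a3; have := M _ _ _ ue a2; have := M _ _ _ ve a3.
rewrite !ler_norml => /andP[v1 v2] /andP[u1 u2] /andP[m1 m2'].
case: (leP (m * x.2) x.1.2) => mx; last first.
  left; right; split => //; rewrite ler_norml; apply/andP; split; lra.
case: (leP (u * x.1.2 + v * x.2) x.1.1) => ux; first by left; left.
right; split => //; rewrite ler_norml; apply/andP; split; lra.
Qed.

Lemma lebesgue3_cone_sector_dist (m u v m' u' v' e : R) :
  `|m - m'| <= e -> `|u - u'| <= e -> `|v - v'| <= e ->
  `|fine (lebesgue3 (cone_sector m u v)) - fine (lebesgue3 (cone_sector m' u' v'))|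
    <= 24 * e.
Proof.
(* The hypotheses are symmetric, so one inequality suffices. The constant is [8 + 8 * 2], from the
   two slabs. *)
have half (a b c a' b' c' : R) :
    `|a - a'| <= e -> `|b - b'| <= e -> `|c - c'| <= e ->
    fine (lebesgue3 (cone_sector a' b' c')) <=
      fine (lebesgue3 (cone_sector a b c)) + 24 * e.
  move=> ae be ce; have e0 : 0 <= e := le_trans (normr_ge0 _) ae.
  rewrite -lee_fin EFinD !fineK ?lebesgue3_cone_sector_fin//.
  have mA := measurable_cone_sector a b c.
  have mB := measurable_slab2 a e.
  have mC := measurable_slab1 b c (2 * e).
  have mAB : measurable (cone_sector a b c `|` slab2 a e) by exact: measurableU.
  apply: (@le_trans _ _ (lebesgue3 (cone_sector a b c `|` slab2 a e `|`
      slab1 b c (2 * e)))).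
    apply: le_measure; rewrite ?inE.
    - exact: measurable_cone_sector.
    - exact: measurableU.
    - exact: cone_sector_perturb.
  apply: (le_trans (measureU2 _ _ _)) => //.
  rewrite (_ : 24 * e = 8 * e + 8 * (2 * e)); last by ring.
  rewrite EFinD addeA; apply: leeD; last by apply: lebesgue3_slab1; lra.
  apply: (le_trans (measureU2 _ _ _)) => //.
  by apply: leeD => //; exact: lebesgue3_slab2.
move=> me ue ve; rewrite ler_distl lerBlDr; apply/andP; split; first exact: half.
by apply: half; rewrite distrC.
Qed.

Lemma cvg_lebesgue3_cone_sector {T : Type} (G : set_system T) {FG : Filter G}
    (m u v : T -> R) (m0 u0 v0 : R) :
  m t @[t --> G] --> m0 -> u t @[t --> G] --> u0 -> v t @[t --> G] --> v0 ->
  fine (lebesgue3 (cone_sector (m t) (u t) (v t))) @[t --> G] -->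
    fine (lebesgue3 (cone_sector m0 u0 v0)).
Proof.
move=> /cvgrPdist_le cm /cvgrPdist_le cu /cvgrPdist_le cv.
apply/cvgrPdist_le => e e0.
have e24 : 0 < e / 24 by rewrite divr_gt0.
near=> t; rewrite -[leRHS](divfK (_ : 24 != 0)) ?pnatr_eq0// mulrC.
apply: lebesgue3_cone_sector_dist; near: t.
- exact: cm.
- exact: cu.
- exact: cv.
Unshelve. all: by end_near.
Qed.

End SolidAngle.

(** * Continuity of the curvatures *)

Lemma triangle_neq {N : nat} (T : {set {set 'I_N}}) (i j k : 'I_N) :
  [set i; j; k]%SET \in simplices T 2 -> [/\ i != j, i != k & j != k].
Proof.
rewrite inE finset.setUC cardsU1 cards2 !inE negb_or => /andP[_].
by rewrite (eq_sym k i) (eq_sym k j); case: (i != j); case: (i != k); case: (j != k).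
Qed.

(** The weight is controlled only on edges of the complex, so the sides of a face must be recognized
    as such edges. *)
Lemma triangle_edges {N : nat} (T : {set {set 'I_N}}) (i j k : 'I_N) :
  simplicial_complex T -> [set i; j; k]%SET \in simplices T 2 ->
  [/\ [set i; j]%SET \in simplices T 1, [set i; k]%SET \in simplices T 1 &
      [set j; k]%SET \in simplices T 1].
Proof.
move=> [_ _ sT] tT; have [ij ik jk] := triangle_neq _ _ _ _ tT.
have edge (a b : 'I_N) : a \in [set i; j; k]%SET -> b \in [set i; j; k]%SET ->
    a != b -> [set a; b]%SET \in simplices T 1.
  move=> aT bT ab; rewrite inE cards2 ab eqxx andbT.
  apply: (sT _ [set i; j; k]%SET).
  - by move: tT; rewrite inE => /andP[].
  - by apply/fintype.subsetP => x; rewrite !inE => /orP[]/eqP->; move: aT bT; rewrite !inE.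
  - by rewrite -card_gt0 cards2.
by split; apply: edge => //; rewrite !inE eqxx ?orbT.
Qed.

(** * Limits of elementary functions along a filter *)

Section Limits.
Context {R : realType} {T : Type} {G : set_system T} {FG : Filter G}.

(** [powR] has a separate value at 0; since [a] is positive, [f t] eventually avoids it and the
    formula with [expR] and [ln] applies. *)
Lemma cvg_powR (f : T -> R) (a p : R) : 0 < a ->
  f t @[t --> G] --> a -> f t `^ p @[t --> G] --> a `^ p.
Proof.
move=> a0 fa; rewrite /powR (gt_eqF a0).
have cl : ln (f t) @[t --> G] --> ln a.
  by apply: continuous_cvg => //; exact: continuous_ln.
have cpl : p * ln (f t) @[t --> G] --> p * ln a by apply: cvgM => //; exact: cvg_cst.
have ce : expR (p * ln (f t)) @[t --> G] --> expR (p * ln a).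
  by apply: continuous_cvg => //; exact: continuous_expR.
apply: cvg_trans; [apply: near_eq_cvg|exact: ce]; near=> t.
have ft : 0 < f t by near: t; exact: cvgr_gt fa _ a0.
by rewrite (gt_eqF ft).
Unshelve. all: by end_near.
Qed.

Lemma cvg_sqrt (f : T -> R) (a : R) :
  f t @[t --> G] --> a -> Num.sqrt (f t) @[t --> G] --> Num.sqrt a.
Proof. by move=> fa; apply: continuous_cvg => //; exact: sqrt_continuous. Qed.

Lemma cvg_sqr (f : T -> R) (a : R) :
  f t @[t --> G] --> a -> f t ^+ 2 @[t --> G] --> a ^+ 2.
Proof. by move=> fa; under eq_cvg do rewrite expr2; rewrite expr2; exact: cvgM. Qed.

Lemma cvg_bigsum {I : Type} (s : seq I) (P : pred I) (f : I -> T -> R) (a : I -> R) :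
  (forall i, P i -> f i t @[t --> G] --> a i) ->
  \sum_(i <- s | P i) f i t @[t --> G] --> \sum_(i <- s | P i) a i.
Proof. by apply: cvg_big; exact: add_continuous. Qed.

Lemma cvg_div (f g : T -> R) (a b : R) : b != 0 ->
  f t @[t --> G] --> a -> g t @[t --> G] --> b ->
  f t / g t @[t --> G] --> a / b.
Proof. by move=> b0 fa gb; apply: cvgM => //; exact: cvgV. Qed.

(** The inequality between squares puts the limiting cosine strictly between -1 and 1, where [acos]
    is continuous. *)
Lemma cvg_triangle_angle (a b c : T -> R) (a0 b0 c0 : R) :
  0 < a0 -> 0 < b0 -> (a0 ^+ 2 + b0 ^+ 2 - c0 ^+ 2) ^+ 2 < (2 * a0 * b0) ^+ 2 ->
  a t @[t --> G] --> a0 -> b t @[t --> G] --> b0 -> c t @[t --> G] --> c0 ->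
  triangle_angle (a t) (b t) (c t) @[t --> G] --> triangle_angle a0 b0 c0.
Proof.
move=> a0_gt0 b0_gt0 lt ca cb cc; rewrite /triangle_angle.
have ab0 : 0 < 2 * a0 * b0 by rewrite !mulr_gt0.
have cq : (a t ^+ 2 + b t ^+ 2 - c t ^+ 2) / (2 * a t * b t) @[t --> G] -->
    (a0 ^+ 2 + b0 ^+ 2 - c0 ^+ 2) / (2 * a0 * b0).
  apply: cvg_div; first by rewrite gt_eqF.
    by apply: cvgB; [apply: cvgD|]; exact: cvg_sqr.
  by apply: cvgM => //; apply: cvgM => //; exact: cvg_cst.
apply: continuous_cvg => //.
apply: continuous_acos; rewrite -ltr_norml normrM normfV (gtr0_norm ab0).
rewrite ltr_pdivrMr// mul1r -(@ltr_pXn2r _ 2) ?nnegrE ?(ltW ab0)//.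
by rewrite real_normK ?num_real.
Qed.

End Limits.

(* The difference of the two sides is 16 times the squared area. *)
Lemma circle_triangle_nondegenerate {R : realFieldType} (a b c A B C : R) :
  0 < a -> 0 < b -> 0 < c -> 0 <= A <= 1 -> 0 <= B <= 1 -> 0 <= C <= 1 ->
  (2 * a ^+ 2 + 2 * a * b * A + 2 * a * c * B - 2 * b * c * C) ^+ 2 <
  4 * (a ^+ 2 + b ^+ 2 + 2 * a * b * A) * (a ^+ 2 + c ^+ 2 + 2 * a * c * B).
Proof.
move=> a0 b0 c0 /andP[A0 A1] /andP[B0 B1] /andP[C0 C1]; rewrite -subr_gt0.
rewrite (_ : _ - _ = 4 * ((a * b) ^+ 2 * (1 - A ^+ 2) + (a * c) ^+ 2 * (1 - B ^+ 2)
  + (b * c) ^+ 2 * (1 - C ^+ 2) + 2 * a * b * c * (b * (B + A * C)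
  + c * (A + B * C) + a * (C + A * B)))); last by ring.
have sq (x : R) : 0 <= x -> x <= 1 -> 0 <= 1 - x ^+ 2.
  by move=> x0 x1; rewrite subr_ge0 expr_le1.
have t1 : 0 <= (a * c) ^+ 2 * (1 - B ^+ 2) by rewrite mulr_ge0 ?sqr_ge0 ?sq.
have t2 : 0 <= (b * c) ^+ 2 * (1 - C ^+ 2) by rewrite mulr_ge0 ?sqr_ge0 ?sq.
have t3 : 0 <= b * (B + A * C).
  by rewrite mulr_ge0 ?addr_ge0 ?mulr_ge0 ?(ltW a0) ?(ltW b0) ?(ltW c0).
have t4 : 0 <= a * (C + A * B).
  by rewrite mulr_ge0 ?addr_ge0 ?mulr_ge0 ?(ltW a0) ?(ltW b0) ?(ltW c0).
have t5 : 0 <= c * (A + B * C).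
  by rewrite mulr_ge0 ?addr_ge0 ?mulr_ge0 ?(ltW a0) ?(ltW b0) ?(ltW c0).
have t6 : 0 < 2 * a * b * c by rewrite !mulr_gt0.
(* All summands are nonnegative. For [A = 1] the term [c * (A + B * C)] is positive, otherwise
   [(a * b) ^+ 2 * (1 - A ^+ 2)] is. *)
rewrite mulr_gt0//; have [A1'|A1'] := eqVneq A 1.
  have t7 : 0 < c * (A + B * C) by rewrite mulr_gt0// A1' ltr_pwDl ?mulr_ge0.
  have t8 : 0 <= (a * b) ^+ 2 * (1 - A ^+ 2) by rewrite mulr_ge0 ?sqr_ge0 ?sq.
  have := mulr_gt0 t6 (ltr_pwDl (ltr_wpDl t3 t7) t4); lra.
have t8 : 0 < (a * b) ^+ 2 * (1 - A ^+ 2).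
  by rewrite mulr_gt0 ?exprn_gt0 ?mulr_gt0// subr_gt0 expr_lt1// lt_neqAle A1'.
have := mulr_ge0 (ltW t6) (addr_ge0 (addr_ge0 t3 t5) t4); lra.
Qed.

(** * Limits of the curvatures along an arbitrary filter, for use both at a point and as time tends
    to infinity *)

Section Curvature.
Context {R : realType} {N : nat}.
Variables (X : Type) (G : set_system X) (FG : Filter G).
Variables (r : X -> 'rV[R]_N) (r0 : 'rV[R]_N).
Hypothesis cvg_r : forall i, r t ord0 i @[t --> G] --> r0 ord0 i.
Implicit Types (T : {set {set 'I_N}}) (Phi : {set 'I_N} -> R).

Lemma cvg_circle_length Phi (i j : 'I_N) :
  circle_length Phi (r t) i j @[t --> G] --> circle_length Phi r0 i j.
Proof.
apply: cvg_sqrt; apply: cvgD.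
  by apply: cvgD; exact: cvg_sqr.
apply: cvgM; last exact: cvg_cst.
by apply: cvgM => //; apply: cvgM => //; exact: cvg_cst.
Qed.

(** Weights in [[0, pi / 2]] have cosines in [[0, 1]], which makes the lengths positive and the
    triangle nondegenerate. *)
Lemma cvg_circle_angle T Phi (i j k : 'I_N) :
  simplicial_complex T -> edge_weight T Phi -> circle_packing_metrics r0 ->
  [set i; j; k]%SET \in simplices T 2 ->
  circle_angle Phi (r t) i j k @[t --> G] --> circle_angle Phi r0 i j k.
Proof.
move=> sT wPhi r0_gt0 ijk.
have [eij eik ejk] := triangle_edges _ _ _ _ sT ijk.
have cosb e : e \in simplices T 1 -> 0 <= cos (Phi e) <= 1.
  move=> /wPhi /andP[P0 P1]; rewrite cos_le1 andbT cos_ge0_pihalf// P1 andbT.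
  by apply: le_trans P0; rewrite oppr_le0 divr_ge0// pi_ge0.
have l2_gt0 (a b : 'I_N) : [set a; b]%SET \in simplices T 1 ->
    0 < r0 ord0 a ^+ 2 + r0 ord0 b ^+ 2
            + 2 * r0 ord0 a * r0 ord0 b * cos (Phi [set a; b]%SET).
  move=> /cosb /andP[c0 _]; have a0 := r0_gt0 a; have b0 := r0_gt0 b.
  by rewrite ltr_pwDl ?addr_gt0 ?exprn_gt0 ?mulr_ge0// ltW.
rewrite /circle_angle /=; apply: cvg_triangle_angle; try exact: cvg_circle_length.
- by rewrite sqrtr_gt0 l2_gt0.
- by rewrite sqrtr_gt0 l2_gt0.
rewrite !exprMn /circle_length.
rewrite (sqr_sqrtr (ltW (l2_gt0 _ _ eij))) (sqr_sqrtr (ltW (l2_gt0 _ _ eik))).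
rewrite (sqr_sqrtr (ltW (l2_gt0 _ _ ejk))).
have := circle_triangle_nondegenerate _ _ _ _ _ _ (r0_gt0 i) (r0_gt0 j) (r0_gt0 k)
  (cosb _ eij) (cosb _ eik) (cosb _ ejk).
by rewrite -subr_gt0 => H; rewrite -subr_gt0; congr (0 < _): H; ring.
Qed.

Lemma cvg_gauss_curvature T Phi (i : 'I_N) :
  simplicial_complex T -> edge_weight T Phi -> circle_packing_metrics r0 ->
  gauss_curvature T Phi (r t) i @[t --> G] --> gauss_curvature T Phi r0 i.
Proof.
move=> sT wPhi r0_gt0; apply: cvgB; first exact: cvg_cst.
apply: cvg_bigsum => j _; apply: cvg_bigsum => k /andP[_ ijk].
exact: cvg_circle_angle ijk.
Qed.

Lemma cvg_ball_Q (i j k l : 'I_N) : (forall m, 0 < r0 ord0 m) ->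
  ball_Q (r t) i j k l @[t --> G] --> ball_Q r0 i j k l.
Proof.
move=> r0_gt0.
have cV m : (r t ord0 m)^-1 @[t --> G] --> (r0 ord0 m)^-1.
  by apply: cvgV => //; rewrite gt_eqF.
have cV2 m : (r t ord0 m ^+ 2)^-1 @[t --> G] --> (r0 ord0 m ^+ 2)^-1.
  by apply: cvgV; [rewrite gt_eqF// exprn_gt0|exact: cvg_sqr].
apply: cvgB; first by apply: cvg_sqr; do 3 apply: cvgD => //.
by apply: cvgM; [exact: cvg_cst|do 3 apply: cvgD => //].
Qed.

(** Finitely many strict inequalities between continuous functions persist nearby. *)
Lemma near_ball_packing_metrics T :
  ball_packing_metrics T r0 -> \forall t \near G, ball_packing_metrics T (r t).
Proof.
move=> [r0_gt0 Q_gt0]; apply: filterI.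
  by apply: filter_forall => i; exact: cvgr_gt (cvg_r i) _ (r0_gt0 i).
do 4 (apply: filter_forall => ?).
case: (boolP (_ \in _)) => [/Q_gt0 Q0|_]; last exact: nearW.
near=> t => _; near: t; exact: cvgr_gt (cvg_ball_Q _ _ _ _ r0_gt0) _ Q0.
Unshelve. all: by end_near.
Qed.

Lemma cvg_ball_solid_angle (i j k l : 'I_N) :
  (forall m, 0 < r0 ord0 m) -> 0 < ball_Q r0 i j k l ->
  ball_solid_angle (r t) i j k l @[t --> G] --> ball_solid_angle r0 i j k l.
Proof.
move=> r0_gt0 Q0.
have cl a b : ball_length (r t) a b @[t --> G] --> ball_length r0 a b by exact: cvgD.
(* In the placement of [ball_tetrahedron], vertex [k] is at [(x, y, 0)] and vertex [l] at
   [(u, v, w)]. *)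
pose x (q : 'rV[R]_N) := ((ball_length q i j) ^+ 2 + (ball_length q i k) ^+ 2
   - (ball_length q j k) ^+ 2) / (2 * ball_length q i j).
pose y (q : 'rV[R]_N) := Num.sqrt ((ball_length q i k) ^+ 2 - (x q) ^+ 2).
pose u (q : 'rV[R]_N) := ((ball_length q i j) ^+ 2 + (ball_length q i l) ^+ 2
   - (ball_length q j l) ^+ 2) / (2 * ball_length q i j).
pose v (q : 'rV[R]_N) := (((ball_length q i k) ^+ 2 + (ball_length q i l) ^+ 2
   - (ball_length q k l) ^+ 2) / 2 - x q * u q) / y q.
pose w (q : 'rV[R]_N) := Num.sqrt ((ball_length q i l) ^+ 2 - (u q) ^+ 2 - (v q) ^+ 2).
have aE (q : 'rV[R]_N) : (forall m, 0 < q ord0 m) -> 0 < ball_Q q i j k l ->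
   [/\ 0 < y q, 0 < w q & ball_solid_angle q i j k l =
     3 * fine (lebesgue3 (cone_sector (v q / w q) (x q / y q)
       ((u q - x q / y q * v q) / w q)))].
  move=> q0 Qq; have [[p_gt0 y_gt0 w_gt0] _] := ball_tetrahedron q0 Qq.
  split; [exact: y_gt0|exact: w_gt0|].
  by rewrite /ball_solid_angle /= solid_angleE.
have [y0 w0 ->] := aE _ r0_gt0 Q0.
have l0 : 2 * ball_length r0 i j != 0 by rewrite gt_eqF// mulr_gt0// addr_gt0.
have cll : 2 * ball_length (r t) i j @[t --> G] --> 2 * ball_length r0 i j.
  by apply: cvgM => //; exact: cvg_cst.
have cx : x (r t) @[t --> G] --> x r0.
  by apply: cvg_div => //; apply: cvgB; [apply: cvgD|]; exact: cvg_sqr.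
have cu : u (r t) @[t --> G] --> u r0.
  by apply: cvg_div => //; apply: cvgB; [apply: cvgD|]; exact: cvg_sqr.
have cy : y (r t) @[t --> G] --> y r0.
  by apply: cvg_sqrt; apply: cvgB; exact: cvg_sqr.
have cv : v (r t) @[t --> G] --> v r0.
  apply: cvg_div => //; first by rewrite gt_eqF.
  apply: cvgB; last exact: cvgM.
  apply: cvgM; last exact: cvg_cst.
  by apply: cvgB; [apply: cvgD|]; exact: cvg_sqr.
have cw : w (r t) @[t --> G] --> w r0.
  by apply: cvg_sqrt; apply: cvgB; [apply: cvgB|]; exact: cvg_sqr.
have cxy : x (r t) / y (r t) @[t --> G] --> x r0 / y r0.
  by apply: cvg_div => //; rewrite gt_eqF.
have cs : 3 * fine (lebesgue3 (cone_sector (v (r t) / w (r t)) (x (r t) / y (r t))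
       ((u (r t) - x (r t) / y (r t) * v (r t)) / w (r t)))) @[t --> G] -->
   3 * fine (lebesgue3 (cone_sector (v r0 / w r0) (x r0 / y r0)
       ((u r0 - x r0 / y r0 * v r0) / w r0))).
  apply: cvgM; first exact: cvg_cst.
  apply: cvg_lebesgue3_cone_sector => //; apply: cvg_div => //; rewrite ?gt_eqF//.
  by apply: cvgB => //; exact: cvgM.
(* The sector formula is available only where the radii and [ball_Q] are positive, which holds
   eventually along [G]. *)
apply: cvg_trans; [apply: near_eq_cvg|exact: cs]; near=> t.
have rt : forall m, 0 < r t ord0 m.
  by near: t; apply: filter_forall => m; exact: cvgr_gt (cvg_r m) _ (r0_gt0 m).
have Qt : 0 < ball_Q (r t) i j k l.
  by near: t; exact: cvgr_gt (cvg_ball_Q _ _ _ _ r0_gt0) _ Q0.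
by have [_ _ ->] := aE _ rt Qt.
Unshelve. all: by end_near.
Qed.

Lemma cvg_scalar_curvature T (i : 'I_N) : ball_packing_metrics T r0 ->
  scalar_curvature T (r t) i @[t --> G] --> scalar_curvature T r0 i.
Proof.
move=> [r0_gt0 Q_gt0]; apply: cvgB; first exact: cvg_cst.
apply: cvg_bigsum => j _; apply: cvg_bigsum => k _.
apply: cvg_bigsum => l /andP[_ /Q_gt0 Q0]; exact: cvg_ball_solid_angle.
Qed.

Section Flow.
Variables (n : nat) (T : {set {set 'I_N}}) (Phi : {set 'I_N} -> R).
Hypotheses (sT : simplicial_complex T) (wPhi : n = 2%N -> edge_weight T Phi).
Hypothesis (r0T : conformal_class n T r0).

Lemma conformal_class_gt0 : forall i, 0 < r0 ord0 i.
Proof. by move: r0T; rewrite /conformal_class; case: ifP => // _ []. Qed.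

Lemma near_conformal_class : \forall t \near G, conformal_class n T (r t).
Proof.
move: r0T; rewrite /conformal_class; case: ifP => _; last exact: near_ball_packing_metrics.
by move=> r0_gt0; apply: filter_forall => i; exact: cvgr_gt (cvg_r i) _ (r0_gt0 i).
Qed.

Lemma cvg_curvature (i : 'I_N) :
  curvature n T Phi (r t) i @[t --> G] --> curvature n T Phi r0 i.
Proof.
move: r0T; rewrite /conformal_class /curvature; case: eqP => [n2|_] H.
  by apply: cvg_gauss_curvature => //; exact: wPhi.
exact: cvg_scalar_curvature.
Qed.

Lemma cvg_flow_field (alpha beta : R) (i : 'I_N) :
  flow_field n T Phi alpha beta (r t) i @[t --> G] --> flow_field n T Phi alpha beta r0 i.
Proof.
have r0_gt0 := conformal_class_gt0.
have cp p j : r t ord0 j `^ p @[t --> G] --> r0 ord0 j `^ p by exact: cvg_powR.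
apply: cvgB; last by apply: cvgM => //; exact: cvg_curvature.
apply: cvgM => //; apply: cvg_div.
(* The index [i] itself shows that the sum has a positive term. *)
- rewrite gt_eqF// (bigD1 i)//= ltr_pwDl ?powR_gt0// sumr_ge0// => j _.
  exact: powR_ge0.
- by apply: cvg_bigsum => j _; apply: cvgM => //; exact: cvg_curvature.
- by apply: cvg_bigsum => j _.
Qed.

End Flow.

End Curvature.

(** * The flow *)

Lemma coord_le_norm {R : realType} {N : nat} (x : 'rV[R]_N) (i : 'I_N) :
  `|x ord0 i| <= `|x|.
Proof.
rewrite [leRHS]mx_normrE.
exact: (le_bigmax _ (fun ij : 'I_1 * 'I_N => `|x ij.1 ij.2|) (ord0, i)).
Qed.

Lemma cvg_row {R : realType} {N : nat} {X : Type} (G : set_system X) {FG : Filter G}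
    (f : X -> 'rV[R]_N) (a : 'rV[R]_N) :
  (forall i, f t ord0 i @[t --> G] --> a ord0 i) -> f t @[t --> G] --> a.
Proof.
move=> H A [P Pa PA]; rewrite /= /fmap /=.
have : \forall t \near G, forall i j, P i j (f t i j).
  by do 2 (apply: filter_forall => ?); rewrite ord1; apply: H; rewrite -?ord1.
by apply: filterS => t /PA.
Qed.

Lemma cvg_coord {R : realType} {N : nat} {X : Type} (G : set_system X) {FG : Filter G}
    (f : X -> 'rV[R]_N) (a : 'rV[R]_N) (i : 'I_N) :
  f t @[t --> G] --> a -> f t ord0 i @[t --> G] --> a ord0 i.
Proof.
move=> fa; apply: (@cvg_comp _ _ _ f (fun M : 'rV[R]_N => M ord0 i) G (nbhs a) _ fa).
exact: coord_continuous.
Qed.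

(** Clearing the denominator makes [u = t] harmless and matches the estimate supplied by
    [peano_local_existence]. *)
Lemma derivative_withinP {R : realType} (I : set R) (f : R -> R) (t d : R) :
  derivative_within I f t d <->
  forall e, 0 < e -> \forall u \near t, I u ->
    `|f u - f t - (u - t) * d| <= `|u - t| * e.
Proof.
split => [/cvgrPdist_le H e e0|H].
  have := H e e0; rewrite near_withinE; apply: filterS => u Hu Iu.
  have [->|ut] := eqVneq u t; first by rewrite !subrr mul0r subrr normr0 mul0r.
  have ut0 : u - t != 0 by rewrite subr_eq0.
  rewrite (_ : _ - _ = (u - t) * ((f u - f t) / (u - t) - d)); last by field.
  rewrite normrM ler_pM2l ?normr_gt0// distrC; apply: Hu; split => //.
  exact/eqP.
apply/cvgrPdist_le => e e0; rewrite near_withinE; have := H e e0.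
apply: filterS => u Hu [Iu /eqP ut]; have ut0 : u - t != 0 by rewrite subr_eq0.
rewrite distrC -(@ler_pM2l _ `|u - t|) ?normr_gt0// -normrM.
rewrite (_ : (u - t) * ((f u - f t) / (u - t) - d) = f u - f t - (u - t) * d); last by field.
exact: Hu.
Qed.

Lemma is_derive_within {R : realType} (I : set R) (f : R -> R) (t d : R) :
  nbhs t I -> derivative_within I f t d -> is_derive t 1 f d.
Proof.
move=> It /derivative_withinP H.
suff c : h^-1 *: ((f \o shift t) (h *: (1 : R)) - f t) @[h --> 0^'] --> d.
  by apply: DeriveDef; [exact: cvgP c|exact: cvg_lim c].
apply/cvgrPdist_le => e e0.
have : \forall u \near t, `|f u - f t - (u - t) * d| <= `|u - t| * e.
  by apply: filterS2 It (H e e0) => u Iu; apply.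
move=> /nbhs_ballP[b /= b0 Hb]; near=> h.
have h0 : h != 0 by near: h; exact: nbhs_dnbhs_neq.
have hb : `|h| < b by near: h; apply: dnbhs0_lt.
have : ball t b (h + t) by rewrite /ball /= opprD addrCA subrr addr0 normrN.
move=> /Hb /=; rewrite addrK => Hh.
rewrite distrC -(@ler_pM2l _ `|h|) ?normr_gt0// -normrM.
rewrite (_ : h * _ = f (h + t) - f t - h * d)//= /GRing.scale /= mulr1 addrC.
by field.
Unshelve. all: by end_near.
Qed.

(* By the mean value theorem [f (t + 1) - f t] is a value of the derivative
   between [t] and [t + 1]; it tends both to 0 and to [L]. *)
Lemma derivative_limit_eq0 {R : realType} (f g : R -> R) (a L : R) :
  (forall t, 0 <= t -> derivative_within `[0, +oo[ f t (g t)) ->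
  f t @[t --> +oo] --> a -> g t @[t --> +oo] --> L -> L = 0.
Proof.
move=> fg /cvgrPdist_le fa /cvgrPdist_le gL.
apply/eqP; rewrite -normr_le0; apply/ler_addgt0Pr => e e0; rewrite add0r.
have e3 : 0 < e / 3 by rewrite divr_gt0.
have [M [_ HM]] := fa _ e3; have [M' [_ HM']] := gL _ e3.
(* Beyond both thresholds, and positive, so that [[t, t + 1]] lies in the interior of the time
   interval and the derivatives are two-sided. *)
pose t := Num.max 0 (Num.max M M') + 1.
have [t0 tM tM'] : [/\ 0 < t, M < t & M' < t].
  by rewrite /t; split; rewrite ltr_pwDr// !le_max lexx ?orbT.
have df u : u \in `[t, t + 1] -> is_derive u 1 f (g u).
  rewrite in_itv /= => /andP[tu _]; have u0 := lt_le_trans t0 tu.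
  apply: is_derive_within (fg u (ltW u0)).
  near=> v; rewrite /= in_itv /= andbT ltW//; near: v; exact: lt_nbhsr.
have dfo u : u \in `]t, t + 1[ -> is_derive u 1 f (g u).
  by move=> /subset_itv_oo_cc; exact: df.
have cf : {within `[t, t + 1], continuous f}.
  by apply: derivable_within_continuous => u /df [].
have tt1 : t < t + 1 by rewrite ltrDl.
have [c] := MVT tt1 dfo cf.
rewrite in_itv /= => /andP[tc _]; rewrite (_ : t + 1 - t = 1) ?mulr1; last by ring.
move=> E.
have h1 := HM _ tM; have h2 := HM _ (lt_trans tM (ltr_pwDr ltr01 (lexx t))).
have h3 := HM' _ (lt_trans tM' tc).
(* Three errors of at most [e / 3] each, since [g c] equals [f (t + 1) - f t]. *)
rewrite (_ : L = (L - g c) + ((a - f t) - (a - f (t + 1)))); last by rewrite -E; ring.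
apply: le_trans (ler_normD _ _) _; apply: le_trans (lerD h3 (ler_normB _ _)) _.
by apply: le_trans (lerD (lexx _) (lerD h1 h2)) _; lra.
Unshelve. all: by end_near.
Qed.

(** Dividing the vanishing field by the positive [beta]-th power of [r_i] gives the quotient
    [s_alpha], which does not depend on the vertex. *)
Lemma flow_critical_point {R : realType} (n N : nat) (T : {set {set 'I_N}})
    (Phi : {set 'I_N} -> R) (alpha beta : R) (r : 'rV[R]_N) :
  conformal_class n T r -> (forall i, flow_field n T Phi alpha beta r i = 0) ->
  constant_curvature_metric n T Phi alpha r.
Proof.
move=> rT F0; split=> //.
suff H i : curvature n T Phi r i / r ord0 i `^ alpha = s_alpha n T Phi alpha r.
  by move=> i j; apply: etrans (H i) (esym (H j)).
have ri := conformal_class_gt0 _ _ _ rT i.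
have a0 : r ord0 i `^ alpha != 0 by rewrite gt_eqF// powR_gt0.
have b0 : r ord0 i `^ beta != 0 by rewrite gt_eqF// powR_gt0.
have := F0 i; rewrite /flow_field powRB; last by rewrite (gt_eqF ri) implybT.
move=> /eqP; rewrite subr_eq0 => /eqP E.
by apply: (mulIf b0); rewrite E; field.
Qed.

Theorem theorem4p2 (R : realType) (n : nat) (hn : n = 2%N \/ n = 3%N)
    (M : topologicalType) (N : nat) (T : {set {set 'I_N}})
    (hT : triangulated_manifold R n M T)
    (Phi : {set 'I_N} -> R) (hPhi : n = 2%N -> edge_weight T Phi)
    (alpha beta : R) :
  [/\ (forall r : 'rV[R]_N, conformal_class n T r ->
         (forall i, flow_field n T Phi alpha beta r i = 0) ->
         constant_curvature_metric n T Phi alpha r),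
      (forall r0 : 'rV[R]_N, conformal_class n T r0 ->
         exists (eps : R) (r : R -> 'rV[R]_N),
           [/\ 0 < eps, r 0 = r0 &
               flow_solution n T Phi alpha beta `[0, eps[ r]) &
      (forall (r : R -> 'rV[R]_N) (rs : 'rV[R]_N),
         flow_solution n T Phi alpha beta `[0, +oo[ r ->
         conformal_class n T rs ->
         r t @[t --> +oo] --> rs ->
         exists r' : 'rV[R]_N, constant_curvature_metric n T Phi alpha r')].
Proof.
have [_ sT _] := hT; split.
- exact: flow_critical_point.
- move=> r0 r0T.
  pose F (r : 'rV[R]_N) : 'rV[R]_N := \row_i flow_field n T Phi alpha beta r i.
  have cid (r : 'rV[R]_N) (i : 'I_N) : q ord0 i @[q --> r] --> r ord0 i.
    exact: coord_continuous.
  (* Openness and continuity are the filter statements applied to the identity map along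
     [nbhs r]. *)
  have oT : open (conformal_class n T : set 'rV[R]_N).
    rewrite openE => r rT; exact: (near_conformal_class _ _ _ id _ (cid r) _ _ rT).
  have cF r : conformal_class n T r -> {for r, continuous F}.
    move=> rT; apply: (@cvg_row _ _ _ (nbhs r) (nbhs_filter r) F (F r)) => i.
    rewrite mxE; under eq_cvg do rewrite mxE.
    exact: (cvg_flow_field _ _ _ id _ (cid r) _ _ _ sT hPhi rT).
  have [eps [x [eps0 x0 Hx]]] := peano_local_existence F _ r0 oT cF r0T.
  exists eps, x; split=> // t; rewrite /= in_itv /= => tI.
  have [xT Hd] := Hx t tI; split=> // i; apply/derivative_withinP => e e0.
  have [d d0 {}Hd] := Hd e e0.
  near=> u => /=; rewrite in_itv /= => uI.
  have ut : `|u - t| < d by rewrite distrC; near: u; exact: nbhsx_ballx.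
  apply: le_trans (Hd u uI ut); apply: le_trans (coord_le_norm _ i).
  by rewrite !mxE.
(* The limit itself is the required metric: each coordinate converges and its derivative converges
   to the field at [rs], which must therefore vanish. *)
- move=> r rs rsol rsT rrs; exists rs; apply: flow_critical_point => // i.
  have cr j : r t ord0 j @[t --> +oo] --> rs ord0 j by exact: cvg_coord.
  apply: (@derivative_limit_eq0 _ (fun t => r t ord0 i)
    (fun t => flow_field n T Phi alpha beta (r t) i) (rs ord0 i)) => //.
  + by move=> t t0; have [|_] := rsol t; [rewrite /= in_itv /= andbT|apply].
  + exact: cvg_flow_field.
Unshelve. all: by end_near.
Qed.
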